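(* Let $\mathcal{H}=\{P_3,K_3\}$ and let $k\geq 3$ be an integer. Then \[\mathcal{E}_\mathcal{H}(k)=\begin{cases}\binom{k+1}{2}-\frac{k+2}{2} & k\text{ even},\\ \binom{k+1}{2}-\frac{k+1}{2} & k\text{ odd}.\end{cases}\] Moreover, the only simple graph $G$ with $\operatorname{ex}(G,\mathcal{H})<k$ attaining this number of edges is $G_k$, where for $k$ odd $G_k=K_{k+1}\setminus\frac{k+1}{2}K_2$ (the complete graph on $k+1$ vertices minus a perfect matching), and for $k$ even $G_k=K_{k+1}\setminus(\frac{k-2}{2}K_2\cup P_2)$ (the complete graph on $k+1$ vertices minus a vertex-disjoint union of $\frac{k-2}{2}$ edges and one path with 2 edges, covering all $k+1$ vertices).
   Context: $P_t$ denotes the path with $t$ edges; $sK_2$ denotes a matching of $s$ edges. Graphs are simple, 2-uniform, without isolated vertices. $\operatorname{ex}(G,\mathcal{H})$ is the maximum number of edges in a subgraph of $G$ containing no member of $\mathcal{H}$, and $\mathcal{E}_\mathcal{H}(k):=\sup\{e(G): G\text{ simple}, \operatorname{ex}(G,\mathcal{H})<k\}$. *)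

(* Defs.v *)
From mathcomp Require Import all_boot.
Set Implicit Arguments. Unset Strict Implicit. Unset Printing Implicit Defensive.

Definition simple_graph (V : finType) (E : {set {set V}}) : Prop :=
  forall e, e \in E -> #|e| = 2.

Definition no_isolated (V : finType) (E : {set {set V}}) : Prop :=
  forall v : V, exists2 e, e \in E & v \in e.

Definition has_P3 (V : finType) (F : {set {set V}}) : bool :=
  [exists a : V, exists b : V, exists c : V, exists d : V,
     [&& uniq [:: a; b; c; d], [set a; b] \in F, [set b; c] \in F
       & [set c; d] \in F]].

Definition has_K3 (V : finType) (F : {set {set V}}) : bool :=
  [exists a : V, exists b : V, exists c : V,
     [&& uniq [:: a; b; c], [set a; b] \in F, [set b; c] \in F
       & [set a; c] \in F]].

Definition ex_P3K3 (V : finType) (E : {set {set V}}) : nat :=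
  \max_(F in powerset E | ~~ has_P3 F && ~~ has_K3 F) #|F|.

Definition EH_value (k : nat) : nat :=
  'C(k.+1, 2) - (if odd k then k.+1 %/ 2 else k.+2 %/ 2).

(* Removed pairs of G_k on vertex set {0,...,k}:
   k odd : the perfect matching {0,1},{2,3},...,{k-1,k};
   k even: the (k-2)/2 edges {0,1},...,{k-4,k-3} together with the
           path k-2 -- k-1 -- k (2 edges).  In both cases this is
           "i %/ 2 = j %/ 2", plus the pair {k-1,k} when k is even. *)
Definition Gk_removed (k : nat) (i j : nat) : bool :=
  (i %/ 2 == j %/ 2)
  || (~~ odd k && (((i == k.-1) && (j == k)) || ((i == k) && (j == k.-1)))).

Definition Gk (k : nat) : {set {set 'I_k.+1}} :=
  [set e : {set 'I_k.+1} | [exists i : 'I_k.+1, exists j : 'I_k.+1,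
     [&& i != j, e == [set i; j] & ~~ Gk_removed k i j]]].

Definition iso_to_Gk (V : finType) (E : {set {set V}}) (k : nat) : Prop :=
  exists2 f : V -> 'I_k.+1, bijective f &
    forall x y : V, ([set x; y] \in E) = ([set f x; f y] \in Gk k).

(* Main.v *)
Require Import Defs.
From mathcomp Require Import all_boot zify.
Set Implicit Arguments. Unset Strict Implicit. Unset Printing Implicit Defensive.

(* A {P_3, K_3}-free graph is a star forest, so ex(G, H) is the largest size of
   a vertex set L in which every vertex has a neighbour outside L (the
   complement of a dominating set), and the upper bound is Vizing's theorem.
   If all such L have size at most s = k - 1, take a vertex v of maximum degree
   D = s - r, with neighbourhood N, and let S be the set of the other vertices.
   Merging the star at v with a star forest of G[S] bounds the latter by r; the
   two stars centred at v and at u in N show that u has at most r + 1 neighbours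
   in S. By induction the degree sum is at most s(s+2) - rD. In the extremal
   case r = 0 and S is independent; if |S| > 1, nearly every vertex of N has at
   most one non-neighbour in N, and two stars centred in N with leaves in S
   cover too much. Hence |S| = 1, G has k + 1 vertices, and counting
   non-neighbours determines its complement. *)


(** * Vizing's bound for a symmetric irreflexive relation *)

Section Vizing.
Variables (V : finType) (R : rel V).
Hypotheses (Rsym : symmetric R) (Rirr : irreflexive R).

Definition nbh (A : {set V}) (x : V) : {set V} := [set y in A | R x y].

Lemma in_nbh (A : {set V}) (x y : V) : (y \in nbh A x) = (y \in A) && R x y.
Proof. by rewrite inE. Qed.

(** Relative to [A] so that the induction can pass to induced subgraphs inside the fixed type
    [V]. *)
Definition codominating (A L : {set V}) : Prop :=
  L \subset A /\ forall x, x \in L -> exists2 y, y \in A :\: L & R x y.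

Lemma sum_nbhC (A B : {set V}) :
  \sum_(x in A) #|nbh B x| = \sum_(y in B) #|nbh A y|.
Proof.
have E (C D : {set V}) : \sum_(x in C) #|nbh D x|
    = \sum_(x in C) \sum_(y in D) (R x y : nat).
  apply: eq_bigr => x _; rewrite -sum1_card big_mkcond /= [RHS]big_mkcond /=.
  by apply: eq_bigr => y _; rewrite inE; case: (y \in D); case: (R x y).
rewrite !E exchange_big; apply: eq_bigr => x _; apply: eq_bigr => y _.
by rewrite Rsym.
Qed.

Lemma card_nbhU (A B : {set V}) (x : V) :
  [disjoint A & B] -> #|nbh (A :|: B) x| = #|nbh A x| + #|nbh B x|.
Proof.
move=> dAB; rewrite -[RHS]cardsUI.
have -> : nbh A x :&: nbh B x = set0.
  apply/setP=> y; rewrite !inE; case yA: (y \in A) => //=.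
  by rewrite (disjointFr dAB yA) andbF.
rewrite cards0 addn0; apply: eq_card => y; rewrite !inE.
by case: (y \in A); case: (y \in B); case: (R x y).
Qed.

Section Star.
Variables (A : {set V}) (v : V) (s : nat).
Hypothesis vA : v \in A.
Hypothesis codomA : forall L, codominating A L -> #|L| <= s.
Let N := nbh A v.
Let S := A :\: (v |: N).

Let vN : v \notin N. Proof. by rewrite inE Rirr andbF. Qed.
Let NA : N \subset A. Proof. by apply/subsetP=> x; rewrite inE => /andP[]. Qed.
Let SA : S \subset A. Proof. exact: subsetDl. Qed.
Let vS : v \notin S. Proof. by rewrite !inE eqxx. Qed.
Let NS x : x \in N -> x \notin S. Proof. by move=> xN; rewrite inE in_setU1 xN orbT. Qed.
Let RvN x : x \in N -> R x v. Proof. by rewrite inE Rsym => /andP[]. Qed.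

Lemma star_partition : A = (v |: N) :|: S.
Proof.
apply/setP=> x; rewrite /S in_setU in_setD.
case xN: (x \in v |: N) => //=.
move: xN; rewrite in_setU1 => /orP[/eqP->|/(subsetP NA)]; by rewrite ?vA.
Qed.

(** [L :|: N] is codominating in [A]: a vertex of [L] keeps its neighbour in [S], and the vertices
    of [N] are adjacent to [v], which lies outside both sets. *)
Lemma codominating_star (L : {set V}) : codominating S L -> #|L| + #|N| <= s.
Proof.
case=> LS domL.
have dLN : L :&: N = set0.
  apply/setP=> x; rewrite in_setI in_set0; apply/negP=> /andP[/(subsetP LS) xS /NS].
  by rewrite xS.
rewrite -cardsUI dLN cards0 addn0; apply: codomA; split.
  by rewrite subUset NA (subset_trans LS).
move=> x; rewrite in_setU => /orP[/domL[y]|xN].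
  rewrite in_setD => /andP[yL yS] Rxy; exists y => //.
  rewrite in_setD in_setU negb_or yL (subsetP SA _ yS) andbT /=.
  by apply: contraL yS => /NS.
exists v; last exact: RvN.
rewrite in_setD in_setU (negPf vN) orbF vA andbT.
by apply: contra vS => /(subsetP LS).
Qed.

(** The leaves are [N :\ u], attached to [v], and [nbh S u], attached to [u]; dropping [u] from [N]
    costs the one in [s.+1]. *)
Lemma codominating_twin_star (u : V) : u \in N -> #|N| + #|nbh S u| <= s.+1.
Proof.
move=> uN; have uS := NS uN.
have uv : u != v by apply: contraNneq vN => <-.
rewrite (cardsD1 u) uN add1n addSn ltnS.
have dis : (N :\ u) :&: nbh S u = set0.
  apply/setP=> x; rewrite in_setI in_set0 in_setD1 (in_nbh S).
  case xN: (x \in N); last by rewrite andbF.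
  by rewrite (negPf (NS xN)) andbF.
rewrite -cardsUI dis cards0 addn0; apply: codomA; split.
  rewrite subUset (subset_trans (subsetDl _ _) NA) /=.
  by apply/subsetP=> x; rewrite in_nbh => /andP[/(subsetP SA)].
move=> x; rewrite in_setU => /orP[|].
  rewrite in_setD1 => /andP[xu xN]; exists v; last exact: RvN.
  by rewrite in_setD in_setU in_setD1 (in_nbh S) (negPf vN) (negPf vS) andbF vA.
rewrite (in_nbh S) => /andP[xS Rux]; exists u; last by rewrite Rsym.
by rewrite in_setD in_setU in_setD1 (in_nbh S) eqxx (negPf uS) /= (subsetP NA).
Qed.

(** Edges between [S] and [v |: N] all end in [N], since [v] has no neighbour in [S]; double
    counting moves their contribution from the vertices of [S] to those of [N]. *)
Lemma sum_nbh_star : \sum_(x in A) #|nbh A x| =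
  #|N| + \sum_(u in N) (#|nbh A u| + #|nbh S u|) + \sum_(x in S) #|nbh S x|.
Proof.
have dis : [disjoint v |: N & S].
  by rewrite disjoint_sym disjoints_subset /S setDE subsetIr.
have BA : v |: N \subset A by rewrite subUset sub1set vA NA.
rewrite (big_setID (v |: N)) (setIidPr BA) big_setU1 //= -/N big_split /= -!addnA; congr (_ + (_ + _)).
rewrite (eq_bigr (fun x => #|nbh (v |: N) x| + #|nbh S x|)); last first.
  by move=> x _; rewrite -card_nbhU // -star_partition.
rewrite big_split /=; congr (_ + _).
rewrite sum_nbhC big_setU1 //=.
suff -> : nbh S v = set0 by rewrite cards0.
apply/setP=> x; rewrite in_nbh /S in_setD in_setU1 in_nbh in_set0.
by case: (R v x); case: (x \in A); rewrite ?andbF ?orbT.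
Qed.

End Star.

(** The product on the left is the slack exploited in the equality case. Vizing's bound for smaller
    sets is a premise, so that the lemma serves both the inductive step and the extremal
    analysis. *)
Lemma sum_nbh_max (A : {set V}) (v : V) (s : nat) :
  v \in A -> (forall x, x \in A -> #|nbh A x| <= #|nbh A v|) ->
  (forall L, codominating A L -> #|L| <= s) ->
  (forall (B : {set V}) r, #|B| < #|A| ->
     (forall L, codominating B L -> #|L| <= r) ->
     \sum_(x in B) #|nbh B x| <= r * r.+2) ->
  \sum_(x in A) #|nbh A x| + (s - #|nbh A v|) * #|nbh A v| <= s * s.+2.
Proof.
move=> vA vmax codomA IH; rewrite (sum_nbh_star vA).
set N := nbh A v; set S := A :\: (v |: N).
have NleS : #|N| <= s.
  have := codominating_star vA codomA (L := set0).
  by rewrite cards0; apply; split; [exact: sub0set | move=> x; rewrite in_set0].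
have sumS : \sum_(x in S) #|nbh S x| <= (s - #|N|) * (s - #|N|).+2.
  apply: IH => [|L /(codominating_star vA codomA)]; last by rewrite -/N; lia.
  apply: proper_card; rewrite properE subsetDl /=.
  by apply/subsetPn; exists v; rewrite // in_setD in_setU1 eqxx.
have sumN : \sum_(u in N) (#|nbh A u| + #|nbh S u|) <= #|N| * s.+1.
  rewrite -sum_nat_const; apply: leq_sum => u uN.
  have := codominating_twin_star vA codomA uN; rewrite -/N -/S.
  have := vmax u; rewrite -/N; move: uN; rewrite in_nbh => /andP[uA _] /(_ uA).
  lia.
(* With [r = s - #|N|] the bounds add up exactly: [#|N| + #|N| * s.+1 + r * r.+2 + r * #|N| = (#|N|
   + r) * s.+2]. *)
nia.
Qed.

Lemma sum_nbh_le (A : {set V}) (s : nat) :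
  (forall L, codominating A L -> #|L| <= s) ->
  \sum_(x in A) #|nbh A x| <= s * s.+2.
Proof.
have [n] := ubnP #|A|; elim: n A s => // n IHn A s; rewrite ltnS => leAn codomA.
have [->|[v0 v0A]] := set_0Vmem A; first by rewrite big_set0.
case: (arg_maxnP (fun x => #|nbh A x|) v0A) => v vA vmax.
apply: leq_trans (sum_nbh_max vA vmax codomA _); first exact: leq_addr.
by move=> B r ltBA; apply: IHn; apply: leq_trans leAn.
Qed.

(** * Number of vertices in the extremal case *)

Section Extremal.
Variable s : nat.
Hypothesis s_gt1 : 1 < s.
Hypothesis codomT : forall L, codominating [set: V] L -> #|L| <= s.
Hypothesis no_isol : forall x, exists y, R x y.
(** The term [odd s] allows for parity: a degree sum is even, while [s * s.+2] is odd for odd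
    [s]. *)
Hypothesis sum_ge : s * s.+2 <= \sum_(x in [set: V]) #|nbh [set: V] x| + odd s.

(** For maximum degree [D], the slack [(s - D) * D] is at most [odd s]. As [D > 0], slack 0 means
    [D = s]; slack 1 would need [s - D = D = 1], so [s = 2], which is even. *)
Lemma extremal_max_nbh : exists2 v, #|nbh [set: V] v| = s &
  forall x, #|nbh [set: V] x| <= s.
Proof.
have [v0 _] : exists v0 : V, true.
  case: (pickP V) => [v0 _|V0]; first by exists v0.
  by move: sum_ge; rewrite big1 => [|x]; [lia | have := V0 x].
case: (arg_maxnP (fun x => #|nbh [set: V] x|) (in_setT v0)) => v _ vmax0.
have vmax x : #|nbh [set: V] x| <= #|nbh [set: V] v| := vmax0 x (in_setT x).
have NleS : #|nbh [set: V] v| <= s.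
  have := codominating_star (in_setT v) codomT (L := set0).
  by rewrite cards0; apply; split; [exact: sub0set | move=> x; rewrite in_set0].
have v_gt0 : 0 < #|nbh [set: V] v|.
  by have [y Rvy] := no_isol v; apply/card_gt0P; exists y; rewrite in_nbh in_setT.
have := sum_nbh_max (in_setT v) (fun x _ => vmax x) codomT
  (fun B r _ => @sum_nbh_le B r).
suff vs : (s - #|nbh [set: V] v|) * #|nbh [set: V] v| <= 1 ->
    (s - #|nbh [set: V] v|) * #|nbh [set: V] v| <= odd s ->
    #|nbh [set: V] v| = s.
  move=> le_sum.
  have eq_v : #|nbh [set: V] v| = s by apply: vs; case: (odd s) sum_ge => /=; lia.
  by exists v => // x; rewrite -eq_v; apply: vmax.
case: (ltngtP #|nbh [set: V] v| s) NleS => // v_lt _ h1 h2.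
have [sv v1] : s - #|nbh [set: V] v| = 1 /\ #|nbh [set: V] v| = 1 by nia.
by have s2 : s = 2 by [lia]; move: h2; rewrite s2 v1.
Qed.

Lemma extremal_card : #|V| = s.+2.
Proof.
have [v vs degs] := extremal_max_nbh.
have := sum_ge; rewrite (sum_nbh_star (in_setT v)) vs.
set N := nbh _ v; set S := _ :\: _.
(* The star at [v] already has [s] leaves, so codominating sets of [S] are empty, and Vizing's bound
   with 0 leaves no edge inside [S]. *)
have S0 x y : x \in S -> y \in S -> ~~ R x y.
  move=> xS yS.
  have : \sum_(x in S) #|nbh S x| <= 0.
    apply: (@sum_nbh_le S 0) => L /(codominating_star (in_setT v) codomT).
    by rewrite vs; lia.
  rewrite leqn0 sum_nat_eq0 => /forall_inP/(_ x xS).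
  rewrite cards_eq0 => /eqP/setP/(_ y).
  by rewrite in_nbh in_set0 yS => /negbT.
have -> : \sum_(x in S) #|nbh S x| = 0.
  apply: big1 => x xS; apply/eqP; rewrite cards_eq0; apply/eqP/setP=> y.
  rewrite in_nbh in_set0; case yS: (y \in S) => //=; apply/negbTE; exact: S0.
have degS u : u \in N -> #|nbh S u| <= 1.
  by move/(codominating_twin_star (in_setT v) codomT); rewrite vs -/S; lia.
(* On N the weight w is at most s + 1 and sums to at least s(s + 1) - 1, so
   the deficits of w add up to at most 1. *)
pose w u := #|nbh [set: V] u| + #|nbh S u|.
rewrite addn0 -[X in s + X]/(\sum_(u in N) w u) => sum_w.
have w_le u : u \in N -> w u <= s.+1.
  by move=> uN; have := degS u uN; have := degs u; rewrite /w; lia.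
have w_pair x y : x \in N -> y \in N -> x != y -> s.*2.+1 <= w x + w y.
  move=> xN yN xy; move: sum_w.
  rewrite (big_setD1 x) //= (big_setD1 y) /=; last by rewrite in_setD1 eq_sym xy.
  have : \sum_(u in N :\ x :\ y) w u <= #|N :\ x :\ y| * s.+1.
    by rewrite -sum_nat_const; apply: leq_sum => u; rewrite !in_setD1 => /and3P[_ _ /w_le].
  have : #|N :\ x :\ y| + 2 = s.
    rewrite -vs -/N (cardsD1 x N) xN (cardsD1 y (N :\ x)) in_setD1 eq_sym xy yN.
    by lia.
  set c := #|_|; set t := \sum_(u in _) _ => cs t_le.
  have : s * s.+2 = c * s.+1 + 2 * s.+1 + s by rewrite -mulnDl cs mulnS addnC.
  move: t_le; move: (c * _) => p; case: (odd s) => /=; lia.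
have deg_split u : u \in N -> #|nbh [set: V] u| = 1 + #|nbh N u| + #|nbh S u|.
  move=> uN; rewrite (star_partition (in_setT v)) -/N -/S.
  rewrite card_nbhU; last first.
    by rewrite disjoint_sym disjoints_subset /S setDE subsetIr.
  rewrite card_nbhU; last by rewrite disjoints1 in_nbh Rirr andbF.
  congr (_ + _ + _); apply/eqP/cards1P; exists v; apply/setP=> y.
  rewrite in_nbh !in_set1; case: eqP => // ->; rewrite Rsym.
  by move: uN; rewrite in_nbh => /andP[].
have S_nbr z : z \in S -> exists2 u, u \in N & R u z.
  move=> zS; have [u Rzu] := no_isol z; exists u; last by rewrite Rsym.
  have := in_setT u; rewrite (star_partition (in_setT v)) -/N -/S in_setU in_setU1 -orbA.
  case/or3P => //; last by move=> uS; have := S0 _ _ zS uS; rewrite Rzu.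
  move/eqP=> uv; move: zS; rewrite /S in_setD in_setU1 in_nbh in_setT.
  by rewrite Rsym -uv Rzu orbT.
(* The stars centred at x1 and x2 with z1, z2, v among their leaves must miss
   some vertex of N, as they would otherwise have s + 1 leaves. *)
have cover x1 x2 z1 z2 : x1 \in N -> x2 \in N -> z1 \in S -> z2 \in S -> z1 != z2 ->
    R x1 z1 -> R x2 z2 -> exists x, [/\ x \in N, x != x1, x != x2, w x <= s &
      exists2 z, z \in S & R x z].
  move=> x1N x2N z1S z2S z12 R1 R2.
  have x12 : x1 != x2.
    apply: contraNneq z12 => x12; apply/eqP; move/card_le1_eqP: (degS _ x1N); apply.
      by rewrite in_nbh z2S x12.
    by rewrite in_nbh z1S.
  have [vN vS] : v \notin N /\ v \notin S.
    by rewrite in_nbh Rirr andbF in_setD in_setU1 eqxx.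
  have NS x : x \in N -> x \notin S by move=> xN; rewrite in_setD in_setU1 xN orbT.
  have [x /and5P[xN xx1 xx2 nR1 nR2]|none] :=
      pickP [pred x | [&& x \in N, x != x1, x != x2, ~~ R x x1 & ~~ R x x2]].
    have degN : #|nbh N x| + 3 <= s.
      have : nbh N x \subset N :\ x :\ x1 :\ x2.
        apply/subsetP=> y; rewrite in_nbh !in_setD1 => /andP[-> Rxy].
        rewrite andbT; apply/and3P; split; apply: contraTneq Rxy => -> //.
        by rewrite Rirr.
      move/subset_leq_card.
      have := cardsD1 x2 (N :\ x :\ x1); have := cardsD1 x1 (N :\ x).
      have := cardsD1 x N; rewrite vs !in_setD1 xN x1N x2N.
      rewrite [x1 == x]eq_sym [x2 == x]eq_sym [x2 == x1]eq_sym xx1 xx2 x12 /=.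
      by move=> -> -> -> h; rewrite !add1n addn3.
    have := w_pair x x1 xN x1N xx1; have := w_le x1 x1N; have := degS x xN.
    have := deg_split x xN => d1 d2 d3 d4.
    (* [w_pair] gives [w x >= s], because [w x1 <= s.+1]; the edge to [v] and at most [s - 3]
       neighbours in [N] do not reach this, so [x] has a neighbour in [S]. *)
    have : 0 < #|nbh S x| by move: degN d1 d3 d4; rewrite /w; clear; lia.
    case/card_gt0P => z; rewrite in_nbh => /andP[zS Rxz].
    exists x; split=> //; last by exists z.
    by move: degN d1 d2; rewrite /w; clear; lia.
  have := @codomT (v |: (z1 |: (z2 |: (N :\ x1 :\ x2)))).
  rewrite !cardsU1.
  have := cardsD1 x2 (N :\ x1); have := cardsD1 x1 N.
  rewrite vs !(in_setU1, in_setD1) x1N x2N [x2 == x1]eq_sym x12 (negPf vN) !andbF.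
  rewrite (negPf z12) /=.
  have -> : (v == z1) = false by apply: contraNF vS => /eqP->.
  have -> : (v == z2) = false by apply: contraNF vS => /eqP->.
  have zN z : z \in S -> (z \in N) = false by move=> zS; apply: contraTF zS => /NS.
  rewrite !zN // !andbF /= => c1 c2 le_s; exfalso.
  suff : codominating [set: V] (v |: (z1 |: (z2 |: (N :\ x1 :\ x2)))).
    by move/le_s; move: c1 c2; clear; lia.
  split; first exact: subsetT.
  have x1L : x1 \in [set: V] :\: (v |: (z1 |: (z2 |: (N :\ x1 :\ x2)))).
    rewrite in_setD !in_setU1 !in_setD1 eqxx /= andbF in_setT andbT orbF.
    by rewrite !negb_or; apply/and3P; split; apply: contraTneq x1N => -> //; rewrite zN.
  have x2L : x2 \in [set: V] :\: (v |: (z1 |: (z2 |: (N :\ x1 :\ x2)))).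
    rewrite in_setD !in_setU1 !in_setD1 eqxx /= in_setT andbT orbF.
    by rewrite !negb_or; apply/and3P; split; apply: contraTneq x2N => -> //; rewrite zN.
  move=> x; rewrite !in_setU1 !in_setD1 => /or4P[/eqP->|/eqP->|/eqP->|].
  - by exists x1 => //; move: x1N; rewrite in_nbh => /andP[].
  - by exists x1 => //; rewrite Rsym.
  - by exists x2 => //; rewrite Rsym.
  move=> /and3P[xx2 xx1 xN]; have := none x; rewrite /= xN xx1 xx2 /=.
  case R1x: (R x x1); first by exists x1.
  by case R2x: (R x x2) => // _; exists x2.
have SV : #|V| = s.+1 + #|S|.
  rewrite -cardsT (star_partition (in_setT v)) -/N -/S cardsU.
  have -> : (v |: N) :&: S = set0.
    by apply/eqP; rewrite setI_eq0 disjoint_sym disjoints_subset /S setDE subsetIr.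
  by rewrite cards0 subn0 cardsU1 in_nbh Rirr andbF vs.
case: (ltngtP #|S| 1) => [S_lt1|/card_gt1P[z1 [z2 [z1S z2S z12]]]|S1]; last by rewrite SV S1 addn1.
  have S00 : S = set0 by apply/eqP; rewrite -cards_eq0; lia.
  (* With [S] empty the weights are plain degrees, and [s * s] falls short of the required total
     because [s > 1]. *)
  have w_le' : \sum_(u in N) w u <= #|N| * s.
    rewrite -sum_nat_const; apply: leq_sum => u _.
    have -> : w u = #|nbh [set: V] u| + 0; last by rewrite addn0.
    by congr (_ + _); apply/eqP; rewrite cards_eq0 -subset0 S00; apply/subsetP=> y; rewrite in_nbh in_set0.
  by move: w_le' sum_w; rewrite vs; case: (odd s) => /=; nia.
have [x1 x1N R1] := S_nbr z1 z1S; have [x2 x2N R2] := S_nbr z2 z2S.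
have [x [xN xx1 xx2 wx [z3 z3S R3]]] := cover _ _ _ _ x1N x2N z1S z2S z12 R1 R2.
(* A second use of [cover], with [x] itself as a centre, yields [y != x]. Both then have weight at
   most [s], against [w_pair]. *)
have [x' [z' [x'N z'S R' z3z']]] : exists x' z',
    [/\ x' \in N, z' \in S, R x' z' & z3 != z'].
  have [z31|z31] := eqVneq z3 z1; first by exists x2, z2; rewrite z31.
  by exists x1, z1.
have [y [yN yx _ wy _]] := cover _ _ _ _ xN x'N z3S z'S z3z' R3 R'.
by move: (w_pair y x yN xN yx) wx wy; move: (w x) (w y); clear; lia.
Qed.
End Extremal.
End Vizing.


(** * Star forests versus codominating sets *)

Section EdgeSets.
Variable V : finType.
Implicit Types (E F : {set {set V}}) (x y : V).

Definition adj E : rel V := fun x y => [set x; y] \in E.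

Lemma adj_sym E : symmetric (adj E).
Proof. by move=> x y; rewrite /adj setUC. Qed.

Lemma adj_irr E : simple_graph E -> irreflexive (adj E).
Proof.
by move=> sE x; apply/negbTE/negP => /sE; rewrite setUid cards1.
Qed.

Lemma edgeP E e x : simple_graph E -> e \in E -> x \in e ->
  exists2 y, y != x & e = [set x; y].
Proof.
move=> sE /sE /eqP/cards2P[a [b [ab ->]]]; rewrite !inE => /orP[]/eqP->.
  by exists b; rewrite // eq_sym.
by exists a; rewrite // setUC.
Qed.

Lemma edge_inj x y z : x != y -> [set x; y] = [set x; z] -> y = z.
Proof.
move=> xy /setP/(_ y); rewrite !inE eqxx orbT eq_sym (negPf xy) /=.
by move/esym/eqP.
Qed.

Lemma handshake E : simple_graph E ->
  \sum_(x in [set: V]) #|nbh (adj E) [set: V] x| = 2 * #|E|.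
Proof.
move=> sE.
transitivity (\sum_(x in [set: V]) \sum_(e in E) (x \in e : nat)).
  apply: eq_bigr => x _; rewrite -big_mkcondr /= sum1_card.
  rewrite -(card_in_imset (f := fun y => [set x; y])); last first.
    move=> y z; rewrite in_nbh in_setT /= => Exy _; apply: edge_inj.
    by apply: contraTneq Exy => ->; rewrite adj_irr.
  apply: eq_card => e; rewrite unfold_in /=; apply/imsetP/andP.
    by case=> y; rewrite in_nbh in_setT => Exy ->; rewrite !inE eqxx.
  case=> eE xe; have [y _ eq_e] := edgeP sE eE xe.
  by exists y; rewrite // in_nbh in_setT /adj -eq_e.
rewrite exchange_big /= mulnC -sum_nat_const; apply: eq_bigr => e eE.
rewrite -(sE e eE) -sum1_card [RHS]big_mkcond /=.
by apply: eq_big => [x|x _]; rewrite ?in_setT //; case: (x \in e).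
Qed.

(** Joining each vertex of [L] to one chosen neighbour outside [L] gives a star forest with [#|L|]
    edges. *)
Lemma codominating_ex E L :
  simple_graph E -> codominating (adj E) [set: V] L -> #|L| <= ex_P3K3 E.
Proof.
move=> sE [_ domL].
(* The default [x] is never reached on [L]. *)
pose c x := odflt x [pick y in [set: V] :\: L | adj E x y].
have cP x : x \in L -> c x \notin L /\ adj E x (c x).
  move=> xL; rewrite /c; case: pickP => [y|none] /=.
    by rewrite in_setD => /andP[/andP[]].
  by have [y yL Exy] := domL x xL; have := none y; rewrite yL Exy.
pose F := [set [set x; c x] | x in L].
have cardF : #|F| = #|L|.
  apply: card_in_imset => x y xL yL /setP/(_ x); rewrite !inE eqxx /=.
  case/esym/orP=> /eqP // xcy; have [] := cP y yL; by rewrite -xcy xL.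
have FP a b : [set a; b] \in F ->
    [&& a \in L, b \notin L & c a == b] || [&& b \in L, a \notin L & c b == a].
  case/imsetP=> x xL eq_ab; have [cL Exc] := cP x xL.
  have xc : x != c x by apply: contraTneq Exc => <-; rewrite adj_irr.
  have : x \in [set a; b] by rewrite eq_ab !inE eqxx.
  rewrite !inE => /orP[]/eqP xe; subst x.
    by rewrite -(edge_inj xc (esym eq_ab)) xL cL eqxx.
  move: eq_ab; rewrite setUC => /esym/(edge_inj xc) <-.
  by rewrite xL cL eqxx orbT.
rewrite -cardF; apply: (@leq_bigmax_cond _ _ (fun F : {set {set V}} => #|F|)).
rewrite powersetE; apply/and3P; split.
- by apply/subsetP=> e /imsetP[x /cP[_ Exc] ->].
- apply/negP=> /existsP[a /existsP[b /existsP[d /existsP[e /and4P[]]]]].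
  rewrite /= !inE !negb_or -!andbA => /and5P[_ ad _ _ /and3P[be _ _]].
  (* The end of the middle edge that lies in [L] has its centre as only neighbour in [F], yet on the
     path it has two. *)
  move=> /FP ab /FP bd /FP de; case/orP: bd => /and3P[h1 h2 /eqP h3].
    case/orP: ab => /and3P[g1 g2 /eqP g3]; first by rewrite h1 in g2.
    by rewrite -g3 -h3 eqxx in ad.
  case/orP: de => /and3P[g1 g2 /eqP g3]; last by rewrite h1 in g2.
  by rewrite -g3 -h3 eqxx in be.
- apply/negP=> /existsP[a /existsP[b /existsP[d /and4P[_]]]].
  (* Every edge of [F] has exactly one end in [L], so [F] is bipartite. *)
  move=> /FP + /FP + /FP.
  by case: (a \in L); case: (b \in L); case: (d \in L); rewrite ?andbF.
Qed.

(** Conversely, every edge of a star forest has an end of degree 1; choosing one such end per edge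
    gives a codominating set of the same size. *)
Lemma ex_codominating E s : simple_graph E ->
  (forall L, codominating (adj E) [set: V] L -> #|L| <= s) -> ex_P3K3 E <= s.
Proof.
move=> sE codomE; apply/bigmax_leqP => F /and3P[].
rewrite powersetE => /subsetP FE noP3 noK3.
have sF : simple_graph F by move=> e /FE /sE.
pose star x := [set f in F | x \in f].
pose leaf (e : {set V}) := [pick x in e | #|star x| == 1].
have leaf_ex e : e \in F -> exists x, leaf e = Some x.
  move=> eF; rewrite /leaf; case: pickP => [x|none]; first by exists x.
  have big x : x \in e -> exists2 z, z \notin e & [set x; z] \in F.
    move=> xe; have := none x; rewrite /= xe /= => /negbT star1.
    have : ~~ (star x \subset [set e]).
      apply: contra star1; rewrite subset1 => /orP[/eqP->|]; first by rewrite cards1.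
      by move=> /eqP/setP/(_ e); rewrite !inE eF xe.
    case/subsetPn => f; rewrite !inE => /andP[fF xf] fe.
    have [z zx eq_f] := edgeP sF fF xf; exists z; last by rewrite -eq_f.
    have [y yx eq_e] := edgeP sF eF xe.
    apply: contraNN fe; rewrite eq_e !inE (negPf zx) /= => /eqP zy.
    by rewrite eq_f zy.
  have : 0 < #|e| by rewrite (sF e eF).
  case/card_gt0P => x xe; have [y yx eq_e] := edgeP sF eF xe.
  have ye : y \in e by rewrite eq_e !inE eqxx orbT.
  have [z ze xz] := big x xe; have [w we yw] := big y ye.
  move: ze we; rewrite eq_e !inE !negb_or => /andP[zx zy] /andP[wx wy].
  have xy : [set x; y] \in F by rewrite -eq_e.
  (* If neither end of [x y] had degree 1, further neighbours [z] of [x] and [w] of [y] would give a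
     triangle when equal and a path [z x y w] otherwise. *)
  have [zw|zw] := eqVneq z w.
    case/negP: noK3; apply/existsP; exists x; apply/existsP; exists y.
    apply/existsP; exists z; rewrite xy zw yw -zw xz /= !inE !negb_or.
    by rewrite eq_sym yx eq_sym zx eq_sym zy.
  case/negP: noP3; apply/existsP; exists z; apply/existsP; exists x.
  apply/existsP; exists y; apply/existsP; exists w.
  rewrite (setUC [set z]) xz xy yw /= !inE !negb_or zx zy zw.
  by rewrite [x == y]eq_sym yx [x == w]eq_sym wx eq_sym wy.
have leafP e x : leaf e = Some x -> x \in e /\ #|star x| = 1.
  by rewrite /leaf; case: pickP => // y /andP[ye /eqP y1] [<-].
have star_uniq x e f : #|star x| = 1 -> e \in F -> f \in F -> x \in e -> x \in f -> e = f.
  move=> x1 eF fF xe xf; have /card_le1_eqP : #|star x| <= 1 by rewrite x1.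
  by apply; rewrite inE ?eF ?fF.
pose L := [set x | Some x \in leaf @: F].
have cardL : #|F| = #|L|.
  rewrite -(card_in_imset (f := leaf)) => [|e f eF fF eq_l].
    rewrite -(card_imset L (@Some_inj _)); apply: eq_card => o.
    apply/idP/imsetP=> [oF|[x xL ->]]; last by move: xL; rewrite inE.
    case/imsetP: (oF) => e eF oe; have [x ex] := leaf_ex e eF.
    by exists x; rewrite ?inE -?ex -?oe.
  have [x ex] := leaf_ex e eF; have [xe x1] := leafP _ _ ex.
  by apply: star_uniq x1 eF fF xe _; rewrite eq_l in ex; case: (leafP _ _ ex).
rewrite cardL; apply: codomE; split=> [|x]; first exact: subsetT.
rewrite inE => /imsetP[e eF /esym ex]; have [xe x1] := leafP _ _ ex.
have [y yx eq_e] := edgeP sF eF xe; exists y; last first.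
  by rewrite /adj -eq_e FE.
(* If [y] were chosen too, it would be chosen for its only edge, which is [e]; but [leaf e] is
   [x]. *)
rewrite !inE andbT; apply/negP=> /imsetP[f fF /esym fy].
have [yf y1] := leafP _ _ fy.
have ef : e = f by apply: star_uniq y1 eF fF _ yf; rewrite eq_e !inE eqxx orbT.
by move: fy; rewrite -ef ex => -[xy]; rewrite xy eqxx in yx.
Qed.

End EdgeSets.


(** * The graph [Gk k] and non-neighbour counts *)

Lemma Gk_removed_sym k i j : Gk_removed k i j = Gk_removed k j i.
Proof. by rewrite /Gk_removed eq_sym; congr (_ || (_ && _)); rewrite orbC !(andbC (j == _)). Qed.

Lemma Gk_removed_refl k i : Gk_removed k i i.
Proof. by rewrite /Gk_removed eqxx. Qed.

Lemma adj_Gk k (i j : 'I_k.+1) : adj (Gk k) i j = ~~ Gk_removed k i j.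
Proof.
rewrite /adj inE; apply/existsP/idP => [[a /existsP[b /and3P[ab /eqP e]]]|nij].
  have : i \in [set a; b] by rewrite -e !inE eqxx.
  have : j \in [set a; b] by rewrite -e !inE eqxx orbT.
  have [ij|ij] := eqVneq i j.
    have : #|[set a; b]| = 1 by rewrite -e ij setUid cards1.
    by rewrite cards2 ab.
  rewrite !inE => /orP[]/eqP jx /orP[]/eqP ix; subst; rewrite ?eqxx // in ij *.
  by rewrite Gk_removed_sym.
exists i; apply/existsP; exists j; rewrite eqxx nij !andbT.
by apply: contraNneq nij => ->; rewrite Gk_removed_refl.
Qed.

Lemma Gk_simple k : simple_graph (Gk k).
Proof.
move=> e; rewrite inE => /existsP[i /existsP[j /and3P[ij /eqP-> _]]].
by rewrite cards2 ij.
Qed.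

Section NonNeighbours.
Variables (V : finType) (E : {set {set V}}).
Hypothesis sE : simple_graph E.

(** The neighbourhood of [x] in the complement graph. *)
Definition conbh x := [set y | (y != x) && ~~ adj E x y].

Lemma card_nbh_conbh x : #|nbh (adj E) [set: V] x| + #|conbh x| = #|V|.-1.
Proof.
have <- : #|[set~ x]| = #|V|.-1 by rewrite cardsC1.
rewrite -[LHS]cardsUI.
have -> : nbh (adj E) [set: V] x :&: conbh x = set0.
  by apply/setP=> y; rewrite !inE; case: (adj E x y); rewrite ?andbF.
rewrite cards0 addn0; apply: eq_card => y; rewrite !inE.
case Exy: (adj E x y); rewrite ?andbT //=; apply/esym.
by apply: contraTneq Exy => ->; rewrite adj_irr.
Qed.

Lemma sum_card_conbh : \sum_(x in [set: V]) #|conbh x| + 2 * #|E| = #|V| * #|V|.-1.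
Proof.
rewrite -handshake // -big_split /= -[X in X * _]cardsT -sum_nat_const.
by apply: eq_bigr => x _; rewrite addnC card_nbh_conbh.
Qed.
End NonNeighbours.

(** Clears the binomial and the halving; [k.+1 + ~~ odd k] is the degree sum of the complement of an
    extremal graph. *)
Lemma EH_valueE k : 0 < k -> 2 * EH_value k + k.+1 + ~~ odd k = k.+1 * k.
Proof.
move=> k0; rewrite /EH_value.
have := bin2 k.+1; have := odd_double_half (k.+1 * k); rewrite oddM /= andNb => /=.
rewrite add0n => e1 e2; rewrite e2 /=.
have := odd_double_half k; case: (odd k) => /= ?; nia.
Qed.


(** A neighbour of [i] in the complement of [Gk k]: the other member of its pair, except that for
    even [k] the unpaired vertex [k] gets the middle [k.-1] of the removed path. *)
Definition partner k i : nat :=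
  if ~~ odd k && (i == k) then k.-1 else if odd i then i.-1 else i.+1.

Lemma Gk_removed_partner k i : 1 < k -> i <= k ->
  [/\ partner k i <= k, partner k i != i & Gk_removed k i (partner k i)].
Proof.
move=> k1 ik; rewrite /Gk_removed /partner.
by case: (odd k) (odd_double_half k) => /= ?; case: (i =P k) => /= ?;
   case: (odd i) (odd_double_half i) => /= ?; split; lia.
Qed.

(** The second alternative is the other complement neighbour of the middle of the removed path. *)
Lemma Gk_removed_eq k i j : 1 < k -> i <= k -> j <= k -> j != i -> Gk_removed k i j ->
  j = partner k i \/ [/\ ~~ odd k, i = k.-1 & j = k].
Proof.
move=> k1 ik jk ji; rewrite /Gk_removed /partner.
case/orP=> [ij|/andP[ok /orP[]/andP[/eqP-> /eqP->]]]; last 2 first.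
- by right.
- by left; rewrite ok eqxx.
left; move: ij; rewrite !divn2.
have := odd_double_half k; have := odd_double_half i; have := odd_double_half j.
case: (odd k) => /=; case: (odd i) => /=; case: (odd j) => /= ? ? ?; case: (i =P k) => /= ?;
  lia.
Qed.

Lemma conbh_Gk_neq0 k (i : 'I_k.+1) : 1 < k -> conbh (Gk k) i != set0.
Proof.
move=> k1; have [pk pi rem] := Gk_removed_partner k1 (ltn_ord i : i <= k).
apply/set0Pn; exists (inord (partner k i)).
by rewrite inE adj_Gk negbK -val_eqE /= inordK // pi rem.
Qed.

Lemma card_conbh_Gk k (i : 'I_k.+1) : 1 < k ->
  #|conbh (Gk k) i| <= 1 + (~~ odd k && (i == inord k.-1)).
Proof.
move=> k1.
have -> : 1 + (~~ odd k && (i == inord k.-1)) =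
    #|[set inord (partner k i) : 'I_k.+1]| +
    #|if ~~ odd k && (i == inord k.-1) then [set ord_max : 'I_k.+1] else set0|.
  by rewrite cards1; case: ifP; rewrite ?cards1 ?cards0.
apply: leq_trans (leq_card_setU _ _); apply/subset_leq_card/subsetP => j.
rewrite inE adj_Gk negbK -val_eqE /= => /andP[ji rem].
have [jp|[ok ik jk]] := Gk_removed_eq k1 (ltn_ord i : i <= k) (ltn_ord j : j <= k) ji rem.
  by rewrite -jp inord_val !inE eqxx.
have -> : i == inord k.-1 by rewrite -ik inord_val.
by rewrite ok !inE -!val_eqE /= jk eqxx orbT.
Qed.

Lemma Gk_no_isolated k : 2 < k -> no_isolated (Gk k).
Proof.
move=> k2 i; have := card_nbh_conbh (@Gk_simple k) i; rewrite card_ord /=.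
have := card_conbh_Gk i (ltnW k2) => c_le c_eq.
have : 0 < #|nbh (adj (Gk k)) [set: 'I_k.+1] i|.
  by move: c_le; case: (_ && _) => /=; lia.
case/card_gt0P => j; rewrite in_nbh => /andP[_ Eij].
by exists [set i; j]; last exact: set21.
Qed.

(** A nonempty codominating [L] misses two vertices: some [y], and either a non-neighbour [z] of [y]
    or, if [z] is in [L], a neighbour of [z] outside [L], which cannot be [y]. *)
Lemma Gk_ex k : 2 < k -> ex_P3K3 (Gk k) < k.
Proof.
move=> k2; suff : ex_P3K3 (Gk k) <= k.-1 by lia.
apply: ex_codominating (@Gk_simple k) _ => L [_ domL].
have [->|[x xL]] := set_0Vmem L; first by rewrite cards0.
have [y /setDP[_ yL] _] := domL x xL.
have /set0Pn[z] := conbh_Gk_neq0 y (ltnW k2); rewrite inE => /andP[zy nEyz].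
suff [t tL ty] : exists2 t, t \notin L & t != y.
  have : 1 < #|~: L| by apply/card_gt1P; exists t, y; rewrite !inE.
  by have := cardsC L; rewrite card_ord; lia.
have [zL|zL] := boolP (z \in L); last by exists z.
have [t /setDP[_ tL] Ezt] := domL z zL; exists t => //.
by apply: contraNneq nEyz => <-; rewrite adj_sym.
Qed.

(** Only this inequality is counted; the reverse one is the general upper bound. *)
Lemma Gk_card_ge k : 2 < k -> EH_value k <= #|Gk k|.
Proof.
move=> k2; have := sum_card_conbh (@Gk_simple k); rewrite card_ord /=.
have := EH_valueE (ltnW (ltnW k2)).
have : \sum_(i in [set: 'I_k.+1]) #|conbh (Gk k) i| <=
    \sum_(i in [set: 'I_k.+1]) (1 + (~~ odd k && (i == inord k.-1))).
  by apply: leq_sum => i _; apply: card_conbh_Gk; apply: ltnW.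
rewrite big_split /= sum_nat_const cardsT card_ord muln1.
have : \sum_(i in [set: 'I_k.+1]) (~~ odd k && (i == inord k.-1) : nat) = ~~ odd k.
  rewrite (bigD1 (inord k.-1)) ?in_setT //= eqxx andbT big1 ?addn0 // => i.
  by case/andP=> _ /negPf->; rewrite andbF.
move=> ->; lia.
Qed.

(** On [A] the relation splits into classes of size two. Listing class after class turns it into
    equality of halved positions, the form used in [Gk_removed]. *)
Lemma pairing_enum (V : finType) (Q : rel V) (A : {set V}) :
  reflexive Q -> symmetric Q ->
  (forall x, x \in A -> exists y,
     [/\ y \in A, y != x & forall z, z \in A -> Q x z = (z == x) || (z == y)]) ->
  exists l, [/\ uniq l, l =i A, ~~ odd (size l) & forall x0 i j,
    i < size l -> j < size l -> Q (nth x0 l i) (nth x0 l j) = (i %/ 2 == j %/ 2)].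
Proof.
move=> Qrefl Qsym; have [n] := ubnP #|A|; elim: n A => // n IHn A.
rewrite ltnS => leAn pairA.
have [->|[x xA]] := set_0Vmem A.
  by exists [::]; split=> // y; rewrite in_set0.
have [y [yA yx Qx]] := pairA x xA.
have Qy z : z \in A -> Q y z = (z == x) || (z == y).
  have [y' [y'A _ Qy]] := pairA y yA => zA; rewrite Qy //.
  have := Qy x xA; rewrite Qsym Qx // eqxx orbT eq_sym (negPf yx) /= => /esym/eqP->.
  by rewrite orbC.
pose B := A :\ x :\ y.
have ltBn : #|B| < n.
  apply: leq_trans leAn; apply: proper_card; apply/properP.
  split; first by rewrite (subset_trans (subsetDl _ _)) ?subsetDl.
  by exists x; rewrite // !inE eqxx andbF.
have BA z : z \in B -> [/\ z \in A, (z == x) = false & (z == y) = false].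
  by rewrite !inE => /and3P[/negPf-> /negPf->].
(* The partner of [z] is neither [x] nor [y], as those are related only to each other and
   themselves. *)
have pairB z : z \in B -> exists t,
    [/\ t \in B, t != z & forall u, u \in B -> Q z u = (u == z) || (u == t)].
  move=> zB; have [zA zx zy] := BA z zB; have [t [tA tz Qz]] := pairA z zA.
  exists t; split=> // [|u /BA[uA _ _]]; last exact: Qz.
  have Qzt : Q z t by rewrite Qz // eqxx orbT.
  rewrite !inE tA andbT; apply/andP; split; apply: contraTneq Qzt => ->.
    by rewrite Qsym Qy // zx zy.
  by rewrite Qsym Qx // zx zy.
have [l [ul lB evl Ql]] := IHn B ltBn pairB.
exists [:: x, y & l]; split=> /=.
- by rewrite ul !inE !lB !inE !eqxx /= andbF eq_sym (negPf yx).
- move=> z; rewrite !inE lB !inE.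
  by case: (z =P x) => [->|_] //=; case: (z =P y) => [->|_].
- by rewrite negbK.
have nthB x0 i : i < size l -> nth x0 l i \in B by move=> il; rewrite -lB mem_nth.
have S2 i : i.+2 %/ 2 = (i %/ 2).+1 by rewrite -addn2 divnDr // addn1.
move=> x0 [|[|i]] [|[|j]] /=; rewrite ?ltnS ?S2 => il jl.
- by rewrite Qrefl.
- by rewrite Qx // eqxx orbT.
- by have [zA zx zy] := BA _ (nthB x0 j jl); rewrite Qx // zx zy.
- by rewrite Qy // eqxx.
- by rewrite Qrefl.
- by have [zA zx zy] := BA _ (nthB x0 j jl); rewrite Qy // zx zy.
- by have [zA zx zy] := BA _ (nthB x0 i il); rewrite Qsym Qx // zx zy.
- by have [zA zx zy] := BA _ (nthB x0 i il); rewrite Qsym Qy // zx zy.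
- by rewrite Ql // eqSS.
Qed.

Lemma iso_of_enum (V : finType) (E : {set {set V}}) k (l : seq V) :
  uniq l -> (forall x, x \in l) -> size l = k.+1 ->
  (forall x0 i j, i <= k -> j <= k ->
     ~~ adj E (nth x0 l i) (nth x0 l j) = Gk_removed k i j) ->
  iso_to_Gk E k.
Proof.
move=> ul lT sl El.
pose f x : 'I_k.+1 := inord (index x l).
have fE x : f x = index x l :> nat by rewrite inordK // -sl index_mem.
have fK x : nth x l (f x) = x by rewrite fE nth_index.
have f_inj : injective f.
  by move=> x y eq_f; rewrite -[x]fK eq_f (set_nth_default y) ?fK // sl ltn_ord.
exists f => [|x y].
  apply: inj_card_bij => //; rewrite card_ord -sl -(card_uniqP ul).
  exact: max_card.
have := adj_Gk (f x) (f y); rewrite /adj => ->.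
rewrite -(El x) -1?ltnS ?ltn_ord // negbK fK.
by rewrite (set_nth_default y) ?fK // sl ltn_ord.
Qed.


(** * Recovering [Gk k] from the non-neighbour counts *)

Section ExtremalIso.
Variables (V : finType) (E : {set {set V}}) (k : nat).
Hypotheses (sE : simple_graph E) (k_gt2 : 2 < k) (cardV : #|V| = k.+1).
Hypothesis conbh_gt0 : forall x, 0 < #|conbh E x|.
Hypothesis sum_conbh : \sum_(x in [set: V]) #|conbh E x| = k.+1 + ~~ odd k.
(** Non-adjacency including equality, to match the reflexive [Gk_removed]. *)
Let Q : rel V := fun x y => ~~ adj E x y.

Let Qrefl : reflexive Q.
Proof. by move=> x; rewrite /Q adj_irr. Qed.

Let Qsym : symmetric Q.
Proof. by move=> x y; rewrite /Q adj_sym. Qed.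

Let QE x z : Q x z = (z == x) || (z \in conbh E x).
Proof. by rewrite inE -/(Q x z); case: eqVneq => [->|_] //=; rewrite Qrefl. Qed.

(** There are [k.+1] positive counts with sum [k.+1], so all are 1 and the complement is a perfect
    matching. *)
Lemma iso_of_conbh_odd : odd k -> iso_to_Gk E k.
Proof.
move=> ok; have c1 x : #|conbh E x| = 1.
  have : \sum_(y in [set: V] :\ x) 1 <= \sum_(y in [set: V] :\ x) #|conbh E y|.
    by apply: leq_sum => y _; apply: conbh_gt0.
  have := sum_conbh; rewrite (big_setD1 x) ?in_setT //= ok sum1_card.
  have := cardsD1 x [set: V]; rewrite cardsT cardV in_setT.
  by have := conbh_gt0 x; clear; lia.
have pairT x : x \in [set: V] -> exists y, [/\ y \in [set: V], y != x &
    forall z, z \in [set: V] -> Q x z = (z == x) || (z == y)].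
  move=> _; have /eqP/cards1P[y cy] := c1 x; exists y; split=> // [|z _].
    by have := set11 y; rewrite -cy inE => /andP[].
  by rewrite QE cy in_set1.
have [l [ul lT _ Ql]] := pairing_enum Qrefl Qsym pairT.
have sl : size l = k.+1.
  by rewrite -cardV -(card_uniqP ul); apply: eq_card => x; rewrite lT in_setT.
apply: (iso_of_enum ul) => // [x|x0 i j ik jk]; first by rewrite lT in_setT.
by rewrite /Gk_removed ok orbF -(Ql x0) // sl ltnS.
Qed.

(** The sum exceeds the number of vertices by one, so a single vertex [c] has two non-neighbours [a]
    and [b]. These have only [c], and the remaining vertices are paired off. *)
Lemma iso_of_conbh_even : ~~ odd k -> iso_to_Gk E k.
Proof.
move=> ok.
have sum_other c : \sum_(y in [set: V] :\ c) #|conbh E y| + #|conbh E c| = k.+2.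
  by have := sum_conbh; rewrite (big_setD1 c) ?in_setT //= ok addnC addn1.
have card_other c : #|[set: V] :\ c| = k.
  by have := cardsD1 c [set: V]; rewrite cardsT cardV in_setT; case.
have [c c2] : exists c, 1 < #|conbh E c|.
  case: (pickP (fun c => 1 < #|conbh E c|)) => [c|none]; first by exists c.
  have : \sum_(x in [set: V]) #|conbh E x| <= \sum_(x in [set: V]) 1.
    by apply: leq_sum => x _; rewrite leqNgt none.
  by rewrite sum_conbh ok sum1_card cardsT cardV; clear; lia.
have eq2 : #|conbh E c| = 2.
  have : \sum_(y in [set: V] :\ c) 1 <= \sum_(y in [set: V] :\ c) #|conbh E y|.
    by apply: leq_sum => y _; apply: conbh_gt0.
  by have := sum_other c; rewrite sum1_card card_other; move: c2; clear; lia.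
have eq1 x : x != c -> #|conbh E x| = 1.
  move=> xc; have := sum_other c; rewrite eq2 (big_setD1 x) ?in_setD1 ?xc //=.
  have : \sum_(y in [set: V] :\ c :\ x) 1 <= \sum_(y in [set: V] :\ c :\ x) #|conbh E y|.
    by apply: leq_sum => y _; apply: conbh_gt0.
  have := cardsD1 x ([set: V] :\ c); rewrite sum1_card card_other in_setD1 xc in_setT.
  by have := conbh_gt0 x; clear; lia.
move/eqP/cards2P: eq2 => [a [b [ab conbh_c]]].
have [ac bc] : a != c /\ b != c.
  have := set21 a b; have := set22 a b.
  by rewrite -conbh_c !inE => /andP[-> _] /andP[-> _].
have Qc z : Q c z = [|| z == c, z == a | z == b] by rewrite QE conbh_c in_set2.
have Qend x z : x != c -> Q x c -> Q x z = (z == x) || (z == c).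
  move=> xc; have /eqP/cards1P[y cy] := eq1 x xc.
  by rewrite !QE cy !in_set1 eq_sym (negPf xc) /= => /eqP->.
have Qa z : Q a z = (z == a) || (z == c) by apply: Qend; rewrite // Qsym Qc eqxx orbT.
have Qb z : Q b z = (z == b) || (z == c) by apply: Qend; rewrite // Qsym Qc eqxx !orbT.
pose A := [set: V] :\ c :\ a :\ b.
have AP x : x \in A -> [/\ (x == a) = false, (x == b) = false & (x == c) = false].
  by rewrite !inE andbT => /and3P[/negPf-> /negPf-> /negPf->].
have pairA x : x \in A -> exists y,
    [/\ y \in A, y != x & forall z, z \in A -> Q x z = (z == x) || (z == y)].
  move=> xA; have [xa xb xc] := AP x xA.
  have /eqP/cards1P[y cy] := eq1 x (negbT xc).
  have Qx z : Q x z = (z == x) || (z == y) by rewrite QE cy in_set1.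
  exists y; split=> //; last first.
    by have := set11 y; rewrite -cy inE => /andP[].
  have Qxy : Q x y by rewrite Qx eqxx orbT.
  rewrite !inE andbT; apply/and3P.
  split; apply: contraTneq Qxy => ->; rewrite Qsym.
  - by rewrite Qb xb xc.
  - by rewrite Qa xa xc.
  - by rewrite Qc xa xb xc.
have [l [ul lA evl Ql]] := pairing_enum Qrefl Qsym pairA.
have sl : size l + 2 = k.
  rewrite -(card_uniqP ul) (eq_card lA); have := card_other c.
  rewrite (cardsD1 a) (cardsD1 b) !inE ac bc eq_sym ab -/A /= => <-.
  by clear; lia.
have l_notin x : x \in l -> [/\ (x == a) = false, (x == b) = false & (x == c) = false].
  by rewrite lA; apply: AP.
(* The middle [c] must land at position [k.-1]; [size l] is even, so the pairs in [l] stay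
   aligned. *)
apply: (@iso_of_enum _ _ _ (l ++ [:: a; c; b])).
- rewrite cat_uniq ul /= !inE !negb_or ab ac [c == b]eq_sym bc /= !andbT.
  by rewrite !lA !inE !eqxx /= !andbF.
- move=> x; rewrite mem_cat lA !inE andbT.
  by case: (x == a); case: (x == b); case: (x == c).
- by rewrite size_cat /= -sl addn3 addn2.
move=> x0 i j ik jk.
have nthP m : m <= k ->
    [\/ m < size l /\ nth x0 (l ++ [:: a; c; b]) m = nth x0 l m,
        m = size l /\ nth x0 (l ++ [:: a; c; b]) m = a |
        (m = (size l).+1 /\ nth x0 (l ++ [:: a; c; b]) m = c) \/
        (m = (size l).+2 /\ nth x0 (l ++ [:: a; c; b]) m = b)].
  rewrite nth_cat -sl; case: (ltngtP m (size l)) => [h|h|->] hm.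
  - by apply: Or31.
  - apply: Or33; case: (m =P (size l).+1) => [->|ne]; [left | right].
      by rewrite subSnn.
    have -> : m = (size l).+2 by move: h hm ne; clear; lia.
    by rewrite -addn2 addKn.
  - by apply: Or32; rewrite subnn.
have nthl m : m < size l -> nth x0 l m \in l by move=> ml; apply: mem_nth.
rewrite -/(Q _ _) /Gk_removed ok /=.
have skl : k.-1 = (size l).+1 by rewrite -sl addn2.
have kl : k = (size l).+2 by rewrite -sl addn2.
have el := odd_double_half (size l); rewrite (negPf evl) in el.
have ba : (b == a) = false by rewrite eq_sym (negPf ab).
have ca : (c == a) = false by rewrite eq_sym (negPf ac).
have cb : (c == b) = false by rewrite eq_sym (negPf bc).
case: (nthP i ik) => [[il ->]|[il ->]|[[il ->]|[il ->]]];
case: (nthP j jk) => [[jl ->]|[jl ->]|[[jl ->]|[jl ->]]];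
  rewrite skl kl ?[Q (nth _ _ _) a]Qsym ?[Q (nth _ _ _) b]Qsym ?[Q (nth _ _ _) c]Qsym.

1: by rewrite Ql //; move: il jl; clear; lia.
all: rewrite ?(Qa, Qb, Qc) ?divn2.
all: try (have [ia ib ic] := l_notin _ (nthl _ il); rewrite ?ia ?ib ?ic).
all: try (have [ja jb jc] := l_notin _ (nthl _ jl); rewrite ?ja ?jb ?jc).
all: rewrite ?eqxx ?(ba, ca, cb, negPf ab, negPf ac, negPf bc) ?orbT /=.
all: try by rewrite il jl !eqxx ?orbT.
all: move: il jl el (odd_double_half i) (odd_double_half j); clear.
all: case: (odd i); case: (odd j) => /=; lia.
Qed.


End ExtremalIso.

(** * Upper bound, attainment and uniqueness *)

Theorem theorem3p16 (k : nat) (hk : 3 <= k) :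
  (* upper bound: every simple graph G with ex(G,H) < k has at most the value *)
  (forall (V : finType) (E : {set {set V}}),
      simple_graph E -> ex_P3K3 E < k -> #|E| <= EH_value k)
  (* the value is attained by G_k *)
  /\ (simple_graph (Gk k) /\ no_isolated (Gk k)
      /\ ex_P3K3 (Gk k) < k /\ #|Gk k| = EH_value k)
  (* uniqueness: G_k is the only extremal graph (without isolated vertices) *)
  /\ (forall (V : finType) (E : {set {set V}}),
      simple_graph E -> no_isolated E -> ex_P3K3 E < k ->
      #|E| = EH_value k -> iso_to_Gk E k).
Proof.
have codom_le (V : finType) (E : {set {set V}}) : simple_graph E -> ex_P3K3 E < k ->
    forall L, codominating (adj E) [set: V] L -> #|L| <= k.-1.
  by move=> sE exE L /(codominating_ex sE); move: exE hk; clear; lia.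
have valE := EH_valueE (ltnW (ltnW hk)).
have upper (V : finType) (E : {set {set V}}) :
    simple_graph E -> ex_P3K3 E < k -> #|E| <= EH_value k.
  move=> sE exE.
  (* Vizing's bound with [s = k.-1] is [2 * #|E| <= k * k - 1]; for even [k] the right side is odd,
     and parity saves one more. *)
  have := sum_nbh_le (@adj_sym _ E) (adj_irr sE) (codom_le _ _ sE exE).
  rewrite handshake //; move: valE hk; clear.
  by case: k => // n /=; case: (odd n) => /=; lia.
split=> //; split.
  split; first exact: Gk_simple.
  split; first exact: Gk_no_isolated.
  split; first exact: Gk_ex.
  apply/eqP; rewrite eqn_leq Gk_card_ge // andbT.
  by apply: upper; [exact: Gk_simple | exact: Gk_ex].
move=> V E sE nE exE cardE.
have nbr x : exists y, adj E x y.
  have [e eE xe] := nE x; have [y _ eq_e] := edgeP sE eE xe.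
  by exists y; rewrite /adj -eq_e.
have s_gt1 : 1 < k.-1 by move: hk; clear; lia.
have codomE := codom_le _ _ sE exE.
have sum_ge : k.-1 * k.-1.+2 <=
    \sum_(x in [set: V]) #|nbh (adj E) [set: V] x| + odd k.-1.
  rewrite handshake // cardE; move: valE hk; clear.
  by case: k => // n /=; case: (odd n) => /=; lia.
have [v _ deg_le] := extremal_max_nbh (@adj_sym _ E) (adj_irr sE) s_gt1 codomE nbr sum_ge.
have cardV : #|V| = k.+1.
  rewrite (extremal_card (@adj_sym _ E) (adj_irr sE) s_gt1 codomE nbr sum_ge).
  by move: hk; clear; lia.
(* Degrees are at most [k.-1], while each vertex has [k] others. *)
have conbh_gt0 x : 0 < #|conbh E x|.
  have := card_nbh_conbh sE x; rewrite cardV /=; have := deg_le x.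
  by move: hk; clear; lia.
have sum_conbh : \sum_(x in [set: V]) #|conbh E x| = k.+1 + ~~ odd k.
  by have := sum_card_conbh sE; rewrite cardV cardE /=; move: valE; clear; lia.
have [ok|ok] := boolP (odd k); first exact: iso_of_conbh_odd.
exact: iso_of_conbh_even.
Qed.
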